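(* Let $n\in\mathbb{Z}$, $m\ge 0$ and $\varepsilon\in\{1,-1\}$, and let $V_{m,\varepsilon}$ be the $(m+1)$-dimensional irreducible representation of $U_q(\mathfrak{sl}_2)$ of type $\varepsilon$. Then, as $U_q'(\mathfrak{gl}_1)$-modules, $$L([n])\otimes V_{m,\varepsilon}=\bigoplus_{k=0}^{m}L([n+m-2k]).$$
   Context: The ground field is $\mathbb{C}(q)$, and $[n]=\frac{q^n-q^{-n}}{q-q^{-1}}$ for $n\in\mathbb{Z}$. $U_q(\mathfrak{sl}_2)$ is the $\mathbb{C}(q)$-algebra generated by $E,F,K,K^{-1}$ with $KK^{-1}=1=K^{-1}K$, $KE=q^2EK$, $KF=q^{-2}FK$, $EF-FE=\frac{K-K^{-1}}{q-q^{-1}}$; it is a Hopf algebra with $\Delta(E)=E\otimes1+K\otimes E$, $\Delta(F)=F\otimes K^{-1}+1\otimes F$, $\Delta(K)=K\otimes K$. For $m\ge0$ and $\varepsilon\in\{1,-1\}$, $V_{m,\varepsilon}$ is the $(m+1)$-dimensional irreducible $U_q(\mathfrak{sl}_2)$-module of type $\varepsilon$, with basis $x_0,\dots,x_m$ and $Ex_i=[m-i+1]x_{i-1}$ for $i>0$, $Ex_0=0$, $Fx_i=\varepsilon[i+1]x_{i+1}$ for $i<m$, $Fx_m=0$, $Kx_i=\varepsilon q^{m-2i}x_i$. $U_q'(\mathfrak{gl}_1)$ is the subalgebra generated by $B=q^{-1}EK^{-1}+F$. Since $\Delta(B)=B\otimes K^{-1}+1\otimes B$, for a $U_q'(\mathfrak{gl}_1)$-module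 $M$ and a $U_q(\mathfrak{sl}_2)$-module $V$, $M\otimes V$ is a $U_q'(\mathfrak{gl}_1)$-module with $B$ acting by $B\otimes K^{-1}+1\otimes B$. For $\lambda\in\mathbb{C}(q)$, $L(\lambda)$ is the one-dimensional $U_q'(\mathfrak{gl}_1)$-module on which $B$ acts by $\lambda$.
   Formalization: The summands are L(ε[n+m−2k]) instead of L([n+m−2k]): for ε=−1 the printed formula fails when n≠0 (e.g. m=0, n=1: B acts on L([1])⊗V_{0,−1} by −1, but on L([1]) by 1). For ε=1 the statement is unchanged. *)

(* Defs.v *)
From HB Require Import structures.
From mathcomp Require Import all_boot all_order all_algebra.
From mathcomp Require Import generic_quotient boolp.
From mathcomp Require Import mxtens.
From mathcomp Require Import ring.

Set Implicit Arguments.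
Unset Strict Implicit.
Unset Printing Implicit Defensive.

Import GRing.Theory.
Local Open Scope ring_scope.
Local Open Scope quotient_scope.

Section QuantumIntegers.
Variables (F : fieldType) (q : F).

Definition qint (n : int) : F := (q ^ n - q ^ (- n)) / (q - q^-1).

Lemma qint0 : qint 0 = 0.
Proof. by rewrite /qint oppr0 subrr mul0r. Qed.

Hypotheses (q_neq0 : q != 0) (q_generic : forall n, q ^+ n.+1 != 1).

Lemma qqV_neq0 : q - q^-1 != 0.
Proof.
rewrite subr_eq0; apply: contra (q_generic 1) => /eqP e.
by rewrite expr2 {2}e divff.
Qed.

Lemma qintS_neq0 n : qint (n%:Z + 1) != 0.
Proof.
rewrite addrC -intS /qint mulf_neq0 ?invr_eq0 ?qqV_neq0 // subr_eq0 -invr_expz -exprnP.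
have := q_generic (n.+1 + n); apply: contra => /eqP e.
by rewrite -addnS exprD {2}e divff // expf_neq0.
Qed.

End QuantumIntegers.

(* Finite-dimensional left modules in coordinates: a acts on column vectors by *)
(* the matrix [ract a].                                                        *)
Section Modules.
Variables (F : fieldType) (A : algType F).

Record rep := Rep {
  rdim : nat;
  ract :> A -> 'M[F]_rdim;
  ract_lin : linear ract;
  ract1 : ract 1 = 1%:M;
  ractM : forall a b, ract (a * b) = ract a *m ract b }.

Definition rep_iso (M N : rep) : Prop :=
  exists (P : 'M[F]_(rdim N, rdim M)) (Q : 'M[F]_(rdim M, rdim N)),
    [/\ P *m Q = 1%:M, Q *m P = 1%:M & forall a : A, P *m M a = N a *m P].

Section DirectSum.
Variables (n : nat) (M : 'I_n -> rep).

Definition dsum_act (a : A) : 'M[F]_(\sum_i rdim (M i)) := \mxdiag_i M i a.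

Lemma mul_mxdiag2 (p : 'I_n -> nat) (B C : forall i, 'M[F]_(p i)) :
  (\mxdiag_i B i) *m (\mxdiag_i C i) = \mxdiag_i (B i *m C i).
Proof.
rewrite [X in _ *m X]/mxdiag mul_mxdiag_mxblock; apply/eq_mxblock => i j.
have [e|_] := eqVneq i j; last by rewrite mulmx0.
by case: _ / e; rewrite !conform_mx_id.
Qed.

Lemma dsum_lin : linear dsum_act.
Proof.
move=> c a b; rewrite /dsum_act -mul_scalar_mx -mxdiagZ mul_mxdiag2 -mxdiagD.
by apply: eq_mxdiag => i; rewrite ract_lin mul_scalar_mx.
Qed.

Lemma dsum_act1 : dsum_act 1 = 1%:M.
Proof. by rewrite -mxdiagZ; apply: eq_mxdiag => i; rewrite ract1. Qed.

Lemma dsum_actM a b : dsum_act (a * b) = dsum_act a *m dsum_act b.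
Proof. by rewrite mul_mxdiag2; apply: eq_mxdiag => i; rewrite ractM. Qed.

Definition direct_sum : rep := Rep dsum_lin dsum_act1 dsum_actM.

End DirectSum.

Inductive gen_subalg (S : A -> Prop) : A -> Prop :=
| GenIn a of S a : gen_subalg S a
| Gen1 : gen_subalg S 1
| GenScale c a of gen_subalg S a : gen_subalg S (c *: a)
| GenAdd a b of gen_subalg S a & gen_subalg S b : gen_subalg S (a + b)
| GenMul a b of gen_subalg S a & gen_subalg S b : gen_subalg S (a * b).

End Modules.

(* U_q(sl_2): the free algebra on E, F, K, K^-1 modulo the ideal generated by *)
(* the relations, built as formal expressions modulo the congruence generated *)
(* by the algebra axioms and the relations.                                   *)
Section Uq.
Variables (F : fieldType) (q : F).

Inductive Uq_expr : Type :=
| XE | XF | XK | XKi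
| Cst of F
| Add of Uq_expr & Uq_expr
| Mul of Uq_expr & Uq_expr.

Local Notation "x +' y" := (Add x y) (at level 50, left associativity).
Local Notation "x *' y" := (Mul x y) (at level 40, left associativity).

Inductive Uq_eq : Uq_expr -> Uq_expr -> Prop :=
| UqRefl x : Uq_eq x x
| UqSym x y of Uq_eq x y : Uq_eq y x
| UqTrans x y z of Uq_eq x y & Uq_eq y z : Uq_eq x z
| UqAddCong x x' y y' of Uq_eq x x' & Uq_eq y y' : Uq_eq (x +' y) (x' +' y')
| UqMulCong x x' y y' of Uq_eq x x' & Uq_eq y y' : Uq_eq (x *' y) (x' *' y')
| UqAddA x y z : Uq_eq (x +' (y +' z)) (x +' y +' z)
| UqAddC x y : Uq_eq (x +' y) (y +' x)
| UqAdd0 x : Uq_eq (Cst 0 +' x) x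
| UqAddN x : Uq_eq (Cst (-1) *' x +' x) (Cst 0)
| UqMulA x y z : Uq_eq (x *' (y *' z)) (x *' y *' z)
| UqMul1l x : Uq_eq (Cst 1 *' x) x
| UqMulDl x y z : Uq_eq ((x +' y) *' z) (x *' z +' y *' z)
| UqMulDr x y z : Uq_eq (x *' (y +' z)) (x *' y +' x *' z)
| UqCstD a b : Uq_eq (Cst (a + b)) (Cst a +' Cst b)
| UqCstM a b : Uq_eq (Cst (a * b)) (Cst a *' Cst b)
| UqCstC a x : Uq_eq (Cst a *' x) (x *' Cst a)
| UqKKi : Uq_eq (XK *' XKi) (Cst 1)
| UqKiK : Uq_eq (XKi *' XK) (Cst 1)
| UqKE : Uq_eq (XK *' XE) (Cst (q ^+ 2) *' (XE *' XK))
| UqKF : Uq_eq (XK *' XF) (Cst (q ^- 2) *' (XF *' XK))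
| UqEF : Uq_eq (XE *' XF +' Cst (-1) *' (XF *' XE))
               (Cst (q - q^-1)^-1 *' (XK +' Cst (-1) *' XKi)).

HB.instance Definition _ := gen_eqMixin Uq_expr.
HB.instance Definition _ := gen_choiceMixin Uq_expr.

Definition Uq_eqb x y : bool := `[< Uq_eq x y >].

Lemma Uq_eqb_refl : reflexive Uq_eqb.
Proof. by move=> x; apply/asboolP/UqRefl. Qed.

Lemma Uq_eqb_sym : symmetric Uq_eqb.
Proof.
by move=> x y; apply/idP/idP => /asboolP xy; apply/asboolP; apply: UqSym.
Qed.

Lemma Uq_eqb_trans : transitive Uq_eqb.
Proof.
move=> y x z /asboolP xy /asboolP yz; apply/asboolP; exact: UqTrans xy yz.
Qed.

Definition Uq_equiv := EquivRel _ Uq_eqb_refl Uq_eqb_sym Uq_eqb_trans.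

Definition Uq : Type := {eq_quot Uq_equiv}.
HB.instance Definition _ := Choice.on Uq.
HB.instance Definition _ := EqQuotient.on Uq.

Definition Uq_class (x : Uq_expr) : Uq := \pi_Uq x.

Lemma Uq_classP x y : Uq_class x = Uq_class y <-> Uq_eq x y.
Proof.
split=> [/eqP|xy]; first by rewrite eqmodE => /asboolP.
by apply/eqP; rewrite eqmodE; apply/asboolP.
Qed.

Lemma Uq_reprK (x : Uq) : Uq_class (repr x) = x.
Proof. exact: reprK. Qed.

Lemma Uq_repr x : Uq_eq (repr (Uq_class x)) x.
Proof. by apply/Uq_classP; rewrite Uq_reprK. Qed.

Definition Uq_add (x y : Uq) : Uq := Uq_class (repr x +' repr y).
Definition Uq_mul (x y : Uq) : Uq := Uq_class (repr x *' repr y).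
Definition Uq_cst (a : F) : Uq := Uq_class (Cst a).
Definition Uq_opp (x : Uq) : Uq := Uq_mul (Uq_cst (-1)) x.
Definition Uq_scale (a : F) (x : Uq) : Uq := Uq_mul (Uq_cst a) x.

Lemma Uq_classD x y : Uq_class (x +' y) = Uq_add (Uq_class x) (Uq_class y).
Proof. by apply/Uq_classP; apply: UqAddCong; apply: UqSym; apply: Uq_repr. Qed.

Lemma Uq_classM x y : Uq_class (x *' y) = Uq_mul (Uq_class x) (Uq_class y).
Proof. by apply/Uq_classP; apply: UqMulCong; apply: UqSym; apply: Uq_repr. Qed.

Lemma Uq_addA : associative Uq_add.
Proof.
move=> x y z; rewrite -[x]Uq_reprK -[y]Uq_reprK -[z]Uq_reprK -!Uq_classD.
exact/Uq_classP/UqAddA.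
Qed.

Lemma Uq_addC : commutative Uq_add.
Proof. by move=> x y; apply/Uq_classP/UqAddC. Qed.

Lemma Uq_add0 : left_id (Uq_cst 0) Uq_add.
Proof.
by move=> x; rewrite -[x]Uq_reprK -Uq_classD; apply/Uq_classP/UqAdd0.
Qed.

Lemma Uq_addN : left_inverse (Uq_cst 0) Uq_opp Uq_add.
Proof.
move=> x; rewrite -[x]Uq_reprK /Uq_opp -Uq_classM -Uq_classD.
exact/Uq_classP/UqAddN.
Qed.

Lemma Uq_mulA : associative Uq_mul.
Proof.
move=> x y z; rewrite -[x]Uq_reprK -[y]Uq_reprK -[z]Uq_reprK -!Uq_classM.
exact/Uq_classP/UqMulA.
Qed.

Lemma Uq_cstC a x : Uq_mul (Uq_cst a) x = Uq_mul x (Uq_cst a).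
Proof.
by rewrite -[x]Uq_reprK -!Uq_classM; apply/Uq_classP/UqCstC.
Qed.

Lemma Uq_mul1l : left_id (Uq_cst 1) Uq_mul.
Proof.
by move=> x; rewrite -[x]Uq_reprK -Uq_classM; apply/Uq_classP/UqMul1l.
Qed.

Lemma Uq_mul1r : right_id (Uq_cst 1) Uq_mul.
Proof. by move=> x; rewrite -Uq_cstC Uq_mul1l. Qed.

Lemma Uq_mulDl : left_distributive Uq_mul Uq_add.
Proof.
move=> x y z; rewrite -[x]Uq_reprK -[y]Uq_reprK -[z]Uq_reprK.
rewrite -!(Uq_classD, Uq_classM); exact/Uq_classP/UqMulDl.
Qed.

Lemma Uq_mulDr : right_distributive Uq_mul Uq_add.
Proof.
move=> x y z; rewrite -[x]Uq_reprK -[y]Uq_reprK -[z]Uq_reprK.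
rewrite -!(Uq_classD, Uq_classM); exact/Uq_classP/UqMulDr.
Qed.

Lemma Uq_cstD a b : Uq_cst (a + b) = Uq_add (Uq_cst a) (Uq_cst b).
Proof. by rewrite -Uq_classD; apply/Uq_classP/UqCstD. Qed.

Lemma Uq_cstM a b : Uq_cst (a * b) = Uq_mul (Uq_cst a) (Uq_cst b).
Proof. by rewrite -Uq_classM; apply/Uq_classP/UqCstM. Qed.

Section Interpretation.
Variables (d : nat) (mE mF mK mKi : 'M[F]_d).

Definition Uq_relations : Prop :=
  [/\ mK *m mKi = 1%:M /\ mKi *m mK = 1%:M,
      mK *m mE = q ^+ 2 *: (mE *m mK),
      mK *m mF = q ^- 2 *: (mF *m mK) &
      mE *m mF - mF *m mE = (q - q^-1)^-1 *: (mK - mKi)].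

Fixpoint Uq_eval (x : Uq_expr) : 'M[F]_d :=
  match x with
  | XE => mE | XF => mF | XK => mK | XKi => mKi
  | Cst a => a%:M
  | Add x y => Uq_eval x + Uq_eval y
  | Mul x y => Uq_eval x *m Uq_eval y
  end.

Lemma Uq_evalP : Uq_relations ->
  forall x y, Uq_eq x y -> Uq_eval x = Uq_eval y.
Proof.
move=> [[KKi KiK] KE KF EF] x y; elim=> {x y} /=.
- by [].
- by [].
- by move=> x y z _ -> _ ->.
- by move=> x x' y y' _ -> _ ->.
- by move=> x x' y y' _ -> _ ->.
- by move=> x y z; rewrite addrA.
- by move=> x y; rewrite addrC.
- by move=> x; rewrite raddf0 add0r.
- by move=> x; rewrite mul_scalar_mx scaleN1r addNr raddf0.
- by move=> x y z; rewrite mulmxA.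
- by move=> x; rewrite mul1mx.
- by move=> x y z; rewrite mulmxDl.
- by move=> x y z; rewrite mulmxDr.
- by move=> a b; rewrite raddfD.
- by move=> a b; rewrite scalar_mxM.
- by move=> a x; rewrite scalar_mxC.
- exact: KKi.
- exact: KiK.
- by rewrite KE mul_scalar_mx.
- by rewrite KF mul_scalar_mx.
- by rewrite !mul_scalar_mx !scaleN1r EF.
Qed.

End Interpretation.

Lemma Uq_1_neq0 : Uq_cst 1 != Uq_cst 0.
Proof.
apply/eqP => /Uq_classP /(@Uq_evalP 1 0 0 1%:M 1%:M) H.
have /H /= : Uq_relations (d := 1) 0 0 1%:M 1%:M.
  by split; rewrite ?(mulmx0, mul0mx, mulmx1, scaler0, subrr).
by move/eqP; rewrite raddf0 -[1%:M]/(1 : 'M[F]_1) oner_eq0.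
Qed.

HB.instance Definition _ :=
  GRing.isZmodule.Build Uq Uq_addA Uq_addC Uq_add0 Uq_addN.
HB.instance Definition _ := GRing.Zmodule_isNzRing.Build Uq
  Uq_mulA Uq_mul1l Uq_mul1r Uq_mulDl Uq_mulDr Uq_1_neq0.

Lemma Uq_scaleA a b (x : Uq) : Uq_scale a (Uq_scale b x) = Uq_scale (a * b) x.
Proof. by rewrite /Uq_scale Uq_cstM Uq_mulA. Qed.

Lemma Uq_scaleDl (x : Uq) :
  {morph Uq_scale^~ x : a b / a + b >-> a + b}.
Proof. by move=> a b; rewrite /Uq_scale Uq_cstD Uq_mulDl. Qed.

Lemma Uq_scaleDr : right_distributive Uq_scale +%R.
Proof. by move=> a x y; apply: Uq_mulDr. Qed.

HB.instance Definition _ := GRing.Zmodule_isLmodule.Build F Uq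
  Uq_scaleA Uq_mul1l Uq_scaleDr Uq_scaleDl.

Lemma Uq_scaleAl a (x y : Uq) : a *: (x * y) = (a *: x) * y.
Proof. exact: Uq_mulA. Qed.

Lemma Uq_scaleAr a (x y : Uq) : a *: (x * y) = x * (a *: y).
Proof. by rewrite /GRing.scale /= /Uq_scale Uq_mulA Uq_cstC -Uq_mulA. Qed.

HB.instance Definition _ := GRing.Lmodule_isLalgebra.Build F Uq Uq_scaleAl.
HB.instance Definition _ := GRing.Lalgebra_isAlgebra.Build F Uq Uq_scaleAr.

Definition uE : Uq := Uq_class XE.
Definition uF : Uq := Uq_class XF.
Definition uK : Uq := Uq_class XK.
Definition uKi : Uq := Uq_class XKi.

Lemma Uq_class_ringE :
  [/\ forall x y, Uq_class (x +' y) = Uq_class x + Uq_class y,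
      forall x y, Uq_class (x *' y) = Uq_class x * Uq_class y,
      forall a x, Uq_class (Cst a *' x) = a *: Uq_class x,
      forall x, Uq_class (Cst (-1) *' x) = - Uq_class x &
      Uq_class (Cst 1) = 1].
Proof. by split=> // *; rewrite (Uq_classD, Uq_classM). Qed.

Lemma Uq_KKi : uK * uKi = 1.
Proof.
by have [_ <- _ _ <-] := Uq_class_ringE; apply/Uq_classP/UqKKi.
Qed.

Lemma Uq_KiK : uKi * uK = 1.
Proof.
by have [_ <- _ _ <-] := Uq_class_ringE; apply/Uq_classP/UqKiK.
Qed.

Lemma Uq_KE : uK * uE = q ^+ 2 *: (uE * uK).
Proof.
have [_ EM EZ _ _] := Uq_class_ringE.
by rewrite -!EM -EZ; apply/Uq_classP/UqKE.
Qed.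

Lemma Uq_KF : uK * uF = q ^- 2 *: (uF * uK).
Proof.
have [_ EM EZ _ _] := Uq_class_ringE.
by rewrite -!EM -EZ; apply/Uq_classP/UqKF.
Qed.

Lemma Uq_EF : uE * uF - uF * uE = (q - q^-1)^-1 *: (uK - uKi).
Proof.
have [ED EM EZ EN _] := Uq_class_ringE.
by rewrite -!EM -!EN -!ED -EZ; apply/Uq_classP/UqEF.
Qed.

Section RepOfMatrices.
Variables (d : nat) (mE mF mK mKi : 'M[F]_d).
Hypothesis rels : Uq_relations mE mF mK mKi.

Definition Uq_act (u : Uq) : 'M[F]_d := Uq_eval mE mF mK mKi (repr u).

Lemma Uq_act_class x : Uq_act (Uq_class x) = Uq_eval mE mF mK mKi x.
Proof. by apply: Uq_evalP => //; apply: Uq_repr. Qed.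

Lemma Uq_act_lin : linear Uq_act.
Proof.
move=> a x y; rewrite -[x]Uq_reprK -[y]Uq_reprK.
rewrite -[a *: _]/(Uq_mul (Uq_cst a) _) -Uq_classM -[_ + _]Uq_classD.
by rewrite !Uq_act_class /= mul_scalar_mx.
Qed.

Lemma Uq_act1 : Uq_act 1 = 1%:M.
Proof. exact: Uq_act_class. Qed.

Lemma Uq_actM x y : Uq_act (x * y) = Uq_act x *m Uq_act y.
Proof. exact: Uq_act_class. Qed.

Definition Uq_rep : rep Uq := Rep Uq_act_lin Uq_act1 Uq_actM.

End RepOfMatrices.

Section IrreducibleModule.
Variables (m : nat) (s : bool).

Definition eps : F := (-1) ^+ s.

(* Column j holds the coordinates of the image of x_j. *)
Definition V_E : 'M[F]_m.+1 :=
  \matrix_(i, j) if j == i.+1 :> nat then qint q (m%:Z - j%:Z + 1) else 0.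
Definition V_F : 'M[F]_m.+1 :=
  \matrix_(i, j) if i == j.+1 :> nat then eps * qint q (j%:Z + 1) else 0.
Definition V_K : 'M[F]_m.+1 :=
  diag_mx (\row_j (eps * q ^ (m%:Z - 2 * j%:Z))).
Definition V_Ki : 'M[F]_m.+1 :=
  diag_mx (\row_j (eps * q ^ (m%:Z - 2 * j%:Z))^-1).

Lemma eps_neq0 : eps != 0.
Proof. by rewrite signr_eq0. Qed.

Lemma V_EF i j : (V_E *m V_F) i j =
  if i == j then qint q (m%:Z - i%:Z) * (eps * qint q (i%:Z + 1)) else 0.
Proof.
rewrite mxE; have [i_lt|i_ge] := ltnP i m; last first.
  rewrite big1 => [|l _]; last first.
    rewrite !mxE ifN ?mul0r //; apply: contraTneq i_ge => e.
    by rewrite -ltnNge -ltnS -e ltn_ord.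
  have -> : (i : nat) = m by apply/eqP; rewrite eqn_leq i_ge -ltnS ltn_ord.
  by rewrite subrr qint0 mul0r if_same.
rewrite (bigD1 (inord i.+1)) //= big1 ?addr0 => [|l /eqP ne]; last first.
  rewrite !mxE ifN ?mul0r //; apply/eqP => e; apply: ne.
  by apply: val_inj; rewrite /= inordK // ltnS.
rewrite !mxE inordK // eqxx eqSS val_eqE.
have [<-|_] := eqVneq i j; last by rewrite mulr0.
by congr (qint q _ * _); rewrite -addn1 PoszD; ring.
Qed.

Lemma V_FE i j : (V_F *m V_E) i j =
  if i == j then eps * qint q i%:Z * qint q (m%:Z - i%:Z + 1) else 0.
Proof.
rewrite mxE; have [i_gt|] := ltnP 0 i; last first.
  rewrite leqn0 => /eqP i0; rewrite big1 => [|l _]; last by rewrite !mxE i0 mul0r.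
  by rewrite i0 qint0 mulr0 mul0r if_same.
have i1 : (i.-1 < m.+1)%N by rewrite (leq_ltn_trans (leq_pred _)).
rewrite (bigD1 (Ordinal i1)) //= big1 ?addr0 => [|l /eqP ne]; last first.
  rewrite !mxE ifN ?mul0r //; apply/eqP => e; apply: ne.
  by apply: val_inj; rewrite /= e.
rewrite !mxE /= prednK // eqxx eq_sym val_eqE.
have [<-|_] := eqVneq i j; last by rewrite mulr0.
by rewrite addrC -intS prednK.
Qed.

Hypotheses (q_neq0 : q != 0) (q_generic : forall n, q ^+ n.+1 != 1).

Lemma V_relations : Uq_relations V_E V_F V_K V_Ki.
Proof.
have qq := qqV_neq0 q_neq0 q_generic.
have w0 j : eps * q ^ (m%:Z - 2 * j) != 0.
  by rewrite mulf_neq0 ?eps_neq0 // expfz_neq0.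
split.
- rewrite /V_K /V_Ki !mulmx_diag.
  by split; rewrite -diag_const_mx; congr diag_mx; apply/rowP => j;
    rewrite !mxE ?divff ?mulVf.
- apply/matrixP => i j; rewrite [RHS]mxE mul_diag_mx mul_mx_diag !mxE.
  case: eqP => [->|_]; last by rewrite mul0r !mulr0.
  have -> : m%:Z - 2 * i%:Z = 2%:Z + (m%:Z - 2 * i.+1%:Z).
    by rewrite intS; ring.
  by rewrite (expfzDr _ _ q_neq0) -exprnP; ring.
- apply/matrixP => i j; rewrite [RHS]mxE mul_diag_mx mul_mx_diag !mxE.
  case: eqP => [->|_]; last by rewrite mul0r !mulr0.
  have -> : m%:Z - 2 * j.+1%:Z = - 2%:Z + (m%:Z - 2 * j%:Z).
    by rewrite intS; ring.
  rewrite (expfzDr (- 2%:Z) _ q_neq0) -(exprnN q 2); ring.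
- apply/matrixP => i j; rewrite [LHS]mxE [X in _ + X]mxE V_EF V_FE !mxE.
  have [_|_] := eqVneq i j; last by rewrite !mulr0n !subr0 mulr0.
  rewrite !mulr1n.
  set x : int := i%:Z; set y : int := m%:Z.
  have -> : (eps * q ^ (y - 2 * x))^-1 = eps * q ^ (- (y - 2 * x)).
    by rewrite invfM invr_sign invr_expz.
  rewrite mulrCA -[eps * _ * _]mulrA -mulrBr -mulrBr [RHS]mulrCA; congr (_ * _).
  have -> : y - 2 * x = y - x - x by ring.
  rewrite /qint !opprD !opprK !(expfzDr _ _ q_neq0) -!invr_expz -!exprnP expr1.
  have e : q - q^-1 = (q * q - 1) / q by field.
  have q2 : q * q - 1 != 0.
    by apply: contraNneq qq => q2; rewrite e q2 mul0r.
  by rewrite e; field; rewrite !expf_neq0 ?q_neq0 ?q2.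
Qed.

Definition V_rep : rep Uq := Uq_rep V_relations.

End IrreducibleModule.

Definition uB : Uq := q^-1 *: (uE * uKi) + uF.

(* gl1 is U_q'(gl_1). *)
Definition gl1_pred : {pred Uq} := fun u => `[< gen_subalg (eq uB) u >].

Lemma gl1_closed : subalg_closed gl1_pred.
Proof.
split=> [|c u v|u v]; rewrite !unfold_in.
- by apply/asboolP; apply: Gen1.
- move=> /asboolP Bu /asboolP Bv; apply/asboolP.
  by apply: GenAdd => //; apply: GenScale.
- by move=> /asboolP Bu /asboolP Bv; apply/asboolP; apply: GenMul.
Qed.

HB.instance Definition _ :=
  GRing.isSubalgClosed.Build F Uq gl1_pred (GRing.subalg_closed_semi gl1_closed).

Definition gl1 : Type := {u : Uq | u \in gl1_pred}.
HB.instance Definition _ := SubChoice.on gl1.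
HB.instance Definition _ := [SubChoice_isSubAlgebra of gl1 by <:].

Lemma uB_gl1 : uB \in gl1_pred.
Proof. by apply/asboolP; apply: GenIn. Qed.

Definition gB : gl1 := Sub uB uB_gl1.

Definition mx_horner d (b : 'M[F]_d) (p : {poly F}) : 'M[F]_d :=
  \sum_(i < size p) p`_i *: b ^+ i.

Lemma mx_hornerE d (b : 'M[F]_d.+1) p : mx_horner b p = horner_mx b p.
Proof.
rewrite /horner_mx /horner_morph horner_coef size_map_poly.
by apply: eq_bigr => i _; rewrite coef_map /= -mul_scalar_mx.
Qed.

Lemma mx_horner_lin d (b : 'M[F]_d) c p r :
  mx_horner b (c *: p + r) = c *: mx_horner b p + mx_horner b r.
Proof.
case: d b => [|d] b; first by rewrite [LHS]flatmx0 [RHS]flatmx0.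
by rewrite !mx_hornerE rmorphD /= horner_mxZ.
Qed.

Lemma mx_horner1 d (b : 'M[F]_d) : mx_horner b 1 = 1%:M.
Proof.
case: d b => [|d] b; first by rewrite [LHS]flatmx0 [RHS]flatmx0.
by rewrite mx_hornerE rmorph1.
Qed.

Lemma mx_hornerM d (b : 'M[F]_d) p r :
  mx_horner b (p * r) = mx_horner b p *m mx_horner b r.
Proof.
case: d b => [|d] b; first by rewrite [LHS]flatmx0 [RHS]flatmx0.
by rewrite !mx_hornerE rmorphM.
Qed.

Lemma mx_hornerX d (b : 'M[F]_d) : mx_horner b 'X = b.
Proof.
case: d b => [|d] b; first by rewrite [LHS]flatmx0 [RHS]flatmx0.
by rewrite mx_hornerE horner_mx_X.
Qed.

Lemma rep_horner (M : rep Uq) (u : Uq) p :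
  M (horner_alg u p) = mx_horner (M u) p.
Proof.
elim/poly_ind: p => [|p c IHp].
  rewrite rmorph0 /mx_horner size_poly0 big_ord0.
  by have := ract_lin M (-1) 0 0; rewrite scaler0 addr0 scaleN1r addNr.
have -> : p * 'X + c%:P = c *: 1 + p * 'X by rewrite addrC alg_polyC.
rewrite mx_horner_lin mx_hornerM mx_hornerX mx_horner1 -IHp.
transitivity (M (c *: 1 + horner_alg u p * u)).
  by congr (M _); rewrite linearP rmorph1 rmorphM /= horner_algX mulr1.
by rewrite ract_lin ractM ract1.
Qed.

Lemma gl1_horner (u : gl1) : exists p, val u = horner_alg uB p.
Proof.
case: u => u /= /asboolP; elim=> {u} [u <-||c u _ [p ->]|u v _ [p ->] _ [r ->]|u v _ [p ->] _ [r ->]].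
- by exists 'X; rewrite horner_algX.
- by exists 1; rewrite rmorph1.
- by exists (c *: p); rewrite linearZ /= mulr_algl.
- by exists (p + r); rewrite rmorphD.
- by exists (p * r); rewrite rmorphM.
Qed.

Section FreeGenerator.
Hypotheses (q_neq0 : q != 0) (q_generic : forall n, q ^+ n.+1 != 1).

Lemma V_rep_B m s i j : (V_rep m s q_neq0 q_generic uB : 'M_m.+1) i j =
  q^-1 * (V_E m i j * (eps s * q ^ (m%:Z - 2 * j%:Z))^-1) + V_F m s i j.
Proof.
rewrite ract_lin ractM /= !(Uq_act_class (V_relations m s q_neq0 q_generic)) /=.
by rewrite mul_mx_diag !mxE.
Qed.

Lemma V_rep_Bk m k (i : 'I_m.+1) : (k <= i)%N ->
  ((V_rep m false q_neq0 q_generic uB : 'M_m.+1) ^+ k) i ord0 =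
  if k == i then \prod_(l < k) qint q (l%:Z + 1) else 0.
Proof.
elim: k i => [|k IHk] i le_ki; first by rewrite expr0 big_ord0 mxE eq_sym -val_eqE mulrb.
rewrite exprS mxE.
have km : (k < m.+1)%N by rewrite ltnW // (leq_ltn_trans le_ki).
have i1 : (i.-1 < m.+1)%N by rewrite (leq_ltn_trans (leq_pred _)).
have ip : i.-1.+1 = i by rewrite prednK // (leq_trans _ le_ki).
have V0 (l : 'I_m.+1) : (l < i.-1)%N ->
    (V_rep m false q_neq0 q_generic uB : 'M_m.+1) i l = 0.
  move=> lt_li; have lt_lSi : (l.+1 < i)%N by rewrite -ip ltnS.
  rewrite V_rep_B !mxE ltn_eqF 1?gtn_eqF ?mul0r ?mulr0 ?addr0 //.
  by rewrite (ltn_trans _ (ltnSn i)) // ltnW.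
rewrite (bigD1 (Ordinal i1)) //= big1 ?addr0 => [|l ne]; last first.
  have [lt_li|le_il] := ltnP l i.-1; first by rewrite V0 ?mul0r.
  have lt_il : (i.-1 < l)%N.
    by rewrite ltn_neqAle le_il andbT; apply: contraNneq ne => e; apply/eqP/val_inj.
  have lt_kl : (k < l)%N by rewrite (leq_ltn_trans _ lt_il) // -ltnS ip.
  by rewrite IHk ?(ltnW lt_kl) // ltn_eqF ?mulr0.
rewrite IHk /=; last by rewrite -ltnS ip.
rewrite -eqSS ip; case: eqP => [e|_]; last by rewrite mulr0.
rewrite V_rep_B !mxE /= ip eqxx ltn_eqF; last first.
  by rewrite (leq_ltn_trans (leq_pred _)).
rewrite mul0r mulr0 add0r /eps mul1r big_ord_recr /= mulrC.
by congr (_ * qint q (_%:Z + 1)); rewrite -e.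
Qed.

Lemma gl1_free p : horner_alg uB p = 0 -> p = 0.
Proof.
move=> p0; apply/eqP; apply: contraT => p_neq0.
pose m := (size p).-1; have size_p : size p = m.+1 by rewrite prednK ?size_poly_gt0.
have := rep_horner (V_rep m false q_neq0 q_generic) uB p.
rewrite p0 => /matrixP /(_ ord_max ord0).
have := ract_lin (V_rep m false q_neq0 q_generic) (-1) 0 0.
rewrite scaler0 addr0 scaleN1r addNr => ->.
rewrite mxE /mx_horner summxE size_p big_ord_recr big1 /= => [|i _]; last first.
  by rewrite mxE V_rep_Bk ?ltn_eqF ?mulr0 //= ltnW // ltn_ord.
rewrite add0r mxE V_rep_Bk // eqxx => /esym/eqP; rewrite mulf_eq0.
rewrite -[p`_m]/(lead_coef p) lead_coef_eq0 (negPf p_neq0) /=.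
by apply: contraTT => _; apply/prodf_neq0 => l _; apply: qintS_neq0.
Qed.

(* U_q'(gl_1) is the polynomial algebra on B, so any matrix b is the action of *)
(* B in a unique module.                                                       *)
Definition gl1_poly (u : gl1) : {poly F} := projT1 (cid (gl1_horner u)).

Lemma gl1_polyE u p : val u = horner_alg uB p -> gl1_poly u = p.
Proof.
move=> up; rewrite /gl1_poly; case: cid => r /= ur; apply/eqP.
by rewrite -subr_eq0; apply/eqP/gl1_free; rewrite rmorphB /= -ur -up subrr.
Qed.

Lemma gl1_polyP u : val u = horner_alg uB (gl1_poly u).
Proof. by rewrite /gl1_poly; case: cid. Qed.

Section RepOfMatrix.
Variables (d : nat) (b : 'M[F]_d).

Definition gl1_act (u : gl1) : 'M[F]_d := mx_horner b (gl1_poly u).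

Lemma gl1_act_lin : linear gl1_act.
Proof.
move=> c u v; rewrite /gl1_act -mx_horner_lin; congr mx_horner.
by apply: gl1_polyE; rewrite [RHS]linearP /= -!gl1_polyP mulr_algl.
Qed.

Lemma gl1_act1 : gl1_act 1 = 1%:M.
Proof.
by rewrite /gl1_act (@gl1_polyE 1 1) ?mx_horner1 // [RHS]rmorph1.
Qed.

Lemma gl1_actM u v : gl1_act (u * v) = gl1_act u *m gl1_act v.
Proof.
rewrite /gl1_act -mx_hornerM; congr mx_horner.
by apply: gl1_polyE; rewrite [RHS]rmorphM /= -!gl1_polyP.
Qed.

Definition gl1_rep : rep gl1 := Rep gl1_act_lin gl1_act1 gl1_actM.

Lemma gl1_rep_B : gl1_rep gB = b.
Proof.
rewrite /= /gl1_act (@gl1_polyE gB 'X) ?mx_hornerX //.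
by rewrite horner_algX.
Qed.

End RepOfMatrix.

Definition gl1_L (lambda : F) : rep gl1 := gl1_rep (lambda%:M : 'M_1).

(* In coordinates, f (x) g is the Kronecker product of matrices. *)
Definition gl1_tensor (M : rep gl1) (V : rep Uq) : rep gl1 :=
  gl1_rep (M gB *t V uKi + 1%:M *t V uB).

End FreeGenerator.

End Uq.

Section RationalFunctions.
Variable k : fieldType.

(* The ground field C(q) is obtained for k = C. *)
Definition ratfun : fieldType := {fraction {poly k}}.

Definition qvar : ratfun := @FracField.tofrac {poly k} 'X.

Lemma qvar_neq0 : qvar != 0.
Proof. by rewrite /qvar tofrac_eq0 polyX_eq0. Qed.

Lemma qvar_generic n : qvar ^+ n.+1 != 1.
Proof.
rewrite /qvar -tofracXn -tofrac1 tofrac_eq.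
by apply/eqP => /(congr1 (fun p : {poly k} => size p)); rewrite size_polyXn size_poly1.
Qed.

Definition qn (n : int) : ratfun := qint qvar n.

Definition Uq_sl2 : algType ratfun := Uq qvar.

Definition Uq_gl1 : algType ratfun := gl1 qvar.

(* V m s is V_(m, (-1)^s). On V_(0, -1) the elements E and F act by 0 and K    *)
(* by -1, hence tensor (L lambda) (V 0 true) is L (- lambda): tensoring with a *)
(* module of type -1 changes the sign of the eigenvalues of B.                 *)
Definition V (m : nat) (s : bool) : rep Uq_sl2 :=
  V_rep m s qvar_neq0 qvar_generic.

Definition L (lambda : ratfun) : rep Uq_gl1 :=
  gl1_L qvar_neq0 qvar_generic lambda.

Definition tensor (M : rep Uq_gl1) (W : rep Uq_sl2) : rep Uq_gl1 :=
  gl1_tensor qvar_neq0 qvar_generic M W.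

End RationalFunctions.

(* Main.v *)
(* On L([n]) (x) V the generator B acts by the tridiagonal matrix [n] K^-1 + B   *)
(* on V. Put p = q^2, b = q^(n+1-m) and a = -q^(-n+1-m). The polynomial          *)
(*   f_k(X) = \prod_(i < m-k) (1 + b p^i X) \prod_(i < k) (1 + a p^i X),         *)
(* a generating function of dual q-Krawtchouk polynomials, telescopes:           *)
(*   f_k(pX) (1 + aX) (1 + bX) = f_k(X) (1 + b p^(m-k) X) (1 + a p^k X).         *)
(* Comparing coefficients shows that the q^binom(j,2) f_k`_j are the coordinates *)
(* of a left eigenvector of this matrix (up to the sign of V) for [n+m-2k].      *)
(* These m+1 eigenvalues are distinct, hence the matrix is diagonalizable.       *)
Require Import Defs.
From mathcomp Require Import all_boot all_order all_algebra.
From mathcomp Require Import complex reals.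
From mathcomp Require Import boolp mxtens ring zify.

Set Implicit Arguments.
Unset Strict Implicit.
Unset Printing Implicit Defensive.

Import GRing.Theory.
Local Open Scope ring_scope.

(** Since B generates U_q'(gl_1), an isomorphism only has to intertwine B ([gl1_intertwine]), so
    [twisted_B], the matrix of B on the tensor product, has to be similar to a diagonal one.
    [qpoch_pair_rec] gives its left eigenvectors, the rows of [eig_mx] ([eig_mx_twisted_B]);
    [qint_inj] separates the eigenvalues, which makes [eig_mx] invertible ([eig_mx_unit]). For type
    -1 every eigenvalue changes sign. *)

(** * Dilation of q-Pochhammer products *)

Section QPochhammer.
Variables (F : fieldType) (p : F).

(** The q-Pochhammer symbol $(-cX; p)_r$ with base [p]. *)
Definition qpoch (c : F) (r : nat) : {poly F} :=
  \prod_(i < r) (1 + (c * p ^+ i) *: 'X).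

Lemma coef_comp_polyZX (f : {poly F}) i : (f \Po (p *: 'X))`_i = p ^+ i * f`_i.
Proof.
rewrite coef_comp_poly; under eq_bigr => j _ do rewrite exprZn coefZ coefXn.
have [lt_i|ge_i] := ltnP i (size f).
  rewrite (bigD1 (Ordinal lt_i)) //= eqxx mulr1 big1 ?addr0 1?mulrC // => j ne.
  by rewrite eq_sym -val_eqE in ne; rewrite (negPf ne) !mulr0.
rewrite nth_default // mulr0 big1 // => j _.
by rewrite gtn_eqF ?mulr0 // (leq_trans _ ge_i).
Qed.

Lemma comp_poly_1DZX (c : F) :
  (1 + c *: 'X) \Po (p *: 'X) = 1 + (c * p) *: 'X :> {poly F}.
Proof. by rewrite comp_polyD comp_polyZ comp_polyX -polyC1 comp_polyC scalerA. Qed.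

(** Dilation turns each factor into the next one: the first is lost and a new last one appears. *)
Lemma qpoch_dilate c r :
  (qpoch c r \Po (p *: 'X)) * (1 + c *: 'X) = qpoch c r * (1 + (c * p ^+ r) *: 'X).
Proof.
elim: r => [|r IHr]; first by rewrite /qpoch big_ord0 -polyC1 comp_polyC expr0 mulr1.
rewrite /qpoch big_ord_recr /= -/(qpoch c r) comp_polyM mulrAC IHr comp_poly_1DZX.
by rewrite -mulrA -exprSr.
Qed.

Lemma size_qpoch c r : (size (qpoch c r) <= r.+1)%N.
Proof.
rewrite /qpoch; apply: leq_trans (size_poly_prod_leq _ _) _.
have: (\sum_(i < r) size (1 + (c * p ^+ i) *: 'X)%R <= \sum_(i < r) 2)%N.
  apply: leq_sum => i _; apply: leq_trans (size_polyD _ _) _.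
  rewrite geq_max size_poly1 /=; apply: leq_trans (size_scale_leq _ _) _.
  by rewrite size_polyX.
by rewrite sum_nat_const card_ord leq_subLR addnS ltnS addnn -muln2.
Qed.

Lemma qpoch_coef0 c r : (qpoch c r)`_0 = 1.
Proof.
rewrite /qpoch -horner_coef0 horner_prod big1 // => i _.
by rewrite hornerD hornerZ hornerX hornerC mulr0 addr0.
Qed.

Lemma coef_mul_1DZX (f : {poly F}) c i :
  (f * (1 + c *: 'X))`_i = f`_i + c * (if i is j.+1 then f`_j else 0).
Proof.
by rewrite mulrDr mulr1 -scalerAr coefD coefZ coefMX; case: i.
Qed.

(** The coefficient of $X^{j+1}$ in the product of two dilation identities; the default 0 stands for
    the coefficient of index -1. *)
Lemma qpoch_pair_rec a b r s j (f := qpoch b r * qpoch a s) :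
  p ^+ j.+1 * f`_j.+1 + (a + b) * (p ^+ j * f`_j)
    + a * b * (if j is i.+1 then p ^+ i * f`_i else 0)
  = f`_j.+1 + (b * p ^+ r + a * p ^+ s) * f`_j
    + a * b * p ^+ (r + s) * (if j is i.+1 then f`_i else 0).
Proof.
have e : (f \Po (p *: 'X)) * (1 + b *: 'X) * (1 + a *: 'X)
    = f * (1 + (b * p ^+ r) *: 'X) * (1 + (a * p ^+ s) *: 'X).
  by rewrite comp_polyM -mulrA mulrACA !qpoch_dilate mulrACA mulrA.
have := congr1 (fun g : {poly F} => g`_j.+1) e.
rewrite /= !(coef_mul_1DZX, coef_comp_polyZX) exprD.
by case: j => [|j] /=; rewrite ?coef_comp_polyZX => E; apply: etrans (etrans E _); ring.
Qed.

End QPochhammer.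

(** * Left eigenvectors of the tridiagonal matrix *)

Section Eigenvectors.
Variables (F : fieldType) (q : F) (n : int) (m : nat).
Hypotheses (q_neq0 : q != 0) (q_generic : forall i, q ^+ i.+1 != 1).

Definition eig_poly (k : nat) : {poly F} :=
  qpoch (q ^+ 2) (q ^ (n + 1 - m%:Z)) (m - k)
  * qpoch (q ^+ 2) (- q ^ (- n + 1 - m%:Z)) k.

(* The factor q^binom(j,2) makes all dilations in the eigenvalue equation powers *)
(* of the dilation by q^2.                                                      *)
Definition eig_coord (k j : nat) : F := q ^+ 'C(j, 2) * (eig_poly k)`_j.

Lemma eig_coord0 k : eig_coord k 0 = 1.
Proof. by rewrite /eig_coord /eig_poly coefM big_ord1 !qpoch_coef0 !mulr1. Qed.

(** [eig_poly k] has degree at most [m]. *)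
Lemma eig_coord_gt k j : (k <= m)%N -> (m < j)%N -> eig_coord k j = 0.
Proof.
move=> le_km lt_mj; rewrite /eig_coord nth_default ?mulr0 //.
apply: leq_trans (size_polyMleq _ _) _.
have := size_qpoch (q ^+ 2) (q ^ (n + 1 - m%:Z)) (m - k).
have := size_qpoch (q ^+ 2) (- q ^ (- n + 1 - m%:Z)) k.
lia.
Qed.

(** With a, b, p as above, $a + b = (q^2-1) q^{-m} [n]$ and $b p^{m-k} + a p^k = (q^2-1) [n+m-2k]$,
    while $ab$ and $ab p^m$ are free of k: only the eigenvalue depends on k. *)
Lemma eig_coord_rec k j : (k <= m)%N ->
  q ^ (2 * j%:Z - m%:Z) * qint q n * eig_coord k j
  + q^-1 * q ^ (2 * j%:Z - m%:Z) * qint q (m%:Z - j%:Z + 1)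
      * (if j is i.+1 then eig_coord k i else 0)
  + qint q (j%:Z + 1) * eig_coord k j.+1
  = qint q (n + m%:Z - 2 * k%:Z) * eig_coord k j.
Proof.
move=> le_km.
have q2 : q ^+ 2 - 1 != 0 by rewrite subr_eq0.
have qq : q - q^-1 = (q ^+ 2 - 1) / q by field.
(* Multiplied by q^binom(j,2) / (q^2 - 1), this recurrence is the goal. *)
have := qpoch_pair_rec (q ^+ 2) (- q ^ (- n + 1 - m%:Z)) (q ^ (n + 1 - m%:Z)) (m - k) k j.
rewrite -/(eig_poly k) /= => e.
apply/subr0_eq.
move/eqP: e; rewrite -subr_eq0 => /eqP e.
rewrite -[RHS](mulr0 (q ^+ 'C(j, 2) / (q ^+ 2 - 1))) -[X in _ = _ * X]e {e}.
(* Every power of q now splits into powers with exponents n, r, k, j, which [field] treats as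
   independent variables. *)
have -> : (m : int) = (m - k)%:Z + k%:Z by rewrite -PoszD subnK.
rewrite /eig_coord /qint qq.
set f := eig_poly k; set r := (m - k)%N.
have D2 (x : int) : 2 * x = x + x by ring.
have qD := expfzDr _ _ q_neq0.
case: j => [|j]; rewrite !binS ?bin0 ?bin1.
  rewrite !(D2, opprD, opprK, qD) -?invr_expz -?exprnP !(exprAC _ 2) !exprD.
  have := expfz_neq0 n q_neq0; have := expf_neq0 r q_neq0; have := expf_neq0 k q_neq0.
  move: (q ^ n) (q ^+ r) (q ^+ k) => N R K K0 R0 N0; rewrite ?(expr0, expr1, expr1z).
  by field; rewrite q2 K0 R0 N0 q_neq0 oner_neq0.
rewrite !(intS, D2, opprD, opprK, qD) -?invr_expz -?exprnP !(exprAC _ 2) !(exprD, exprS).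
have := expfz_neq0 n q_neq0; have := expf_neq0 r q_neq0; have := expf_neq0 k q_neq0.
have := expf_neq0 j q_neq0; move: (q ^ n) (q ^+ r) (q ^+ k) (q ^+ j) (q ^+ 'C(j, 2)) => N R K J C J0 K0 R0 N0.
rewrite ?(expr0, expr1, expr1z).
by field; rewrite -expr2 q2 K0 R0 N0 q_neq0 J0.
Qed.

Definition eig_mx : 'M[F]_m.+1 := \matrix_(k, j) eig_coord k j.

Definition eig_val (s : bool) (k : nat) : F :=
  (-1) ^+ s * qint q (n + m%:Z - 2 * k%:Z).

Definition twisted_B (s : bool) : 'M[F]_m.+1 :=
  qint q n *: V_Ki q m s + V_rep m s q_neq0 q_generic (uB q).

Lemma sum_mul_if_eq (G : nat -> F) (c : nat) (x : F) d :
  \sum_(i < d) G i * (if i == c :> nat then x else 0)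
  = if (c < d)%N then G c * x else 0.
Proof.
have [lt_cd|le_dc] := ltnP c d.
  rewrite (bigD1 (Ordinal lt_cd)) //= eqxx big1 ?addr0 // => i /negPf.
  by rewrite -val_eqE /= => ->; rewrite mulr0.
by rewrite big1 // => i _; rewrite ltn_eqF ?mulr0 // (leq_trans _ le_dc).
Qed.

Lemma sum_mul_if_Seq (G : nat -> F) (c : nat) (x : F) d : (c <= d)%N ->
  \sum_(i < d) G i * (if c == i.+1 then x else 0)
  = (if c is i.+1 then G i else 0) * x.
Proof.
case: c => [_|c lt_cd]; first by rewrite mul0r big1 // => i _; rewrite mulr0.
under eq_bigr => i _ do rewrite eqSS eq_sym.
by rewrite sum_mul_if_eq lt_cd.
Qed.

(** $K^{-1}$, $EK^{-1}$ and F each carry the sign of V exactly once, so the same eigenvectors serve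
    both types. *)
Lemma eig_mx_twisted_B s :
  eig_mx *m twisted_B s = diag_mx (\row_k eig_val s k) *m eig_mx.
Proof.
apply/matrixP => k j; rewrite mul_diag_mx [in RHS]mxE [in RHS]mxE [LHS]mxE.
have le_km : (k <= m)%N by rewrite -ltnS.
pose x : F := (eps F s * q ^ (m%:Z - 2 * j%:Z))^-1.
have xE : x = eps F s * q ^ (2 * j%:Z - m%:Z).
  by rewrite /x invfM invr_sign invr_expz opprB.
have T_ij i : twisted_B s i j =
    (if i == j :> nat then qint q n * x else 0)
    + q^-1 * x * (if j == i.+1 :> nat then qint q (m%:Z - j%:Z + 1) else 0)
    + (if i == j.+1 :> nat then eps F s * qint q (j%:Z + 1) else 0).
  rewrite [LHS]mxE V_rep_B !mxE -/x addrA; congr (_ + _ + _); last by ring.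
  rewrite -val_eqE; case: eqP => [e|_]; last by rewrite mulr0.
  by rewrite mulr1n /x; congr (_ * (_ * q ^ (_ - 2 * _))^-1); rewrite e.
under eq_bigr => i _ do rewrite [eig_mx _ _]mxE T_ij !mulrDr.
rewrite !big_split /= !(sum_mul_if_eq (eig_coord k)) ltn_ord.
under [X in _ + X + _]eq_bigr => i _ do rewrite mulrCA.
rewrite -mulr_sumr sum_mul_if_Seq; last exact: ltnW.
(* In the last column the entry below the diagonal is missing, but its coefficient vanishes
   anyway. *)
have -> : (if (j.+1 < m.+1)%N then eig_coord k j.+1 * (eps F s * qint q (j%:Z + 1)) else 0)
  = eig_coord k j.+1 * (eps F s * qint q (j%:Z + 1)).
  by case: ltnP => // le_mj; rewrite eig_coord_gt ?mul0r.
rewrite ?mxE /eig_val -[RHS]mulrA -eig_coord_rec // xE /eps.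
by case: {T_ij xE x} j => -[|j] lt_j /=; ring.
Qed.

(** Equality gives $(q^{a-b}-1)(q^{a+b}+1) = 0$. If the second factor vanishes, then $q^{2(a+b)} =
    1$, so $a+b = 0$ and the factor equals 2. *)
Lemma qint_inj (a b : int) : (2%:R : F) != 0 -> qint q a = qint q b -> a = b.
Proof.
move=> two_neq0; have q_exp_inj (c : int) : q ^ c = 1 -> c = 0.
  have nat_case i : q ^+ i = 1 -> i = 0%N.
    by case: i => // i /eqP; rewrite (negPf (q_generic i)).
  case: c => i; first by rewrite -exprnP => /nat_case ->.
  by rewrite NegzE -exprnN => /eqP; rewrite invr_eq1 => /eqP /nat_case.
have qD := expfzDr _ _ q_neq0.
move/(mulIf (invr_neq0 (qqV_neq0 q_neq0 q_generic))) => e.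
have : (q ^ (a - b) - 1) * (q ^ (a + b) + 1) = 0.
  have qa := expfz_neq0 a q_neq0; have qb := expfz_neq0 b q_neq0.
  transitivity (q ^ a * ((q ^ a - q ^ (- a)) - (q ^ b - q ^ (- b)))).
    by rewrite !qD -!invr_expz; field; rewrite qa qb.
  by rewrite e subrr mulr0.
move/eqP; rewrite mulf_eq0 subr_eq0 => /orP[/eqP /q_exp_inj /eqP|].
  by rewrite subr_eq0 => /eqP.
rewrite addr_eq0 => /eqP qab.
have ab0 : a + b = 0.
  have /q_exp_inj : q ^ (a + b + (a + b)) = 1 by rewrite qD qab mulrNN mulr1.
  by lia.
move: qab; rewrite ab0 expr0z => /eqP; rewrite -addr_eq0.
by rewrite (negPf two_neq0).
Qed.

(* Every row of eig_mx starts with 1, so multiplying eig_mx by the Krylov matrix *)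
(* of the first basis vector gives the Vandermonde matrix of the eigenvalues.    *)
Lemma eig_mx_unit : (2%:R : F) != 0 -> eig_mx \in unitmx.
Proof.
move=> two_neq0; pose s := false; pose D := diag_mx (\row_k eig_val s k) : 'M[F]_m.+1.
pose e0 : 'cV[F]_m.+1 := delta_mx 0 0.
pose C := \matrix_(i, l < m.+1) (twisted_B s ^+ l *m e0) i 0.
have powE l : eig_mx *m twisted_B s ^+ l = D ^+ l *m eig_mx.
  elim: l => [|l IHl]; first by rewrite !expr0 mulmx1 mul1mx.
  by rewrite !exprSr mulmxA IHl -!mulmxA eig_mx_twisted_B.
have DE l : D ^+ l = diag_mx (\row_k eig_val s k ^+ l).
  elim: l => [|l IHl].
    by rewrite expr0 -[LHS]/(1%:M) -diag_const_mx; congr diag_mx; apply/rowP => i; rewrite !mxE.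
  rewrite exprSr IHl -[_ * _]/(_ *m _) mulmx_diag.
  by congr diag_mx; apply/rowP => i; rewrite !mxE exprSr.
have CE : eig_mx *m C = (Vandermonde m.+1 (\row_k eig_val s k))^T.
  apply/matrixP => i l; rewrite [RHS]mxE [RHS]mxE [X in _ = X ^+ _]mxE.
  transitivity ((eig_mx *m (twisted_B s ^+ l *m e0)) i 0).
    by rewrite !mxE; apply: eq_bigr => t _; rewrite [C _ _]mxE.
  rewrite mulmxA powE DE -mulmxA mul_diag_mx mxE mxE.
  by rewrite /e0 -colE !mxE eig_coord0 mulr1.
have: \det (eig_mx *m C) != 0.
  rewrite CE det_tr det_Vandermonde; apply/prodf_neq0 => i _; apply/prodf_neq0 => l lt_il.
  rewrite !mxE subr_eq0; apply: contraTneq lt_il.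
  move/(mulfI (eps_neq0 F s))/(qint_inj two_neq0) => ?; rewrite -leqNgt.
  by lia.
by rewrite det_mulmx mulf_eq0 unitmxE unitfE; case/norP.
Qed.

End Eigenvectors.

(** * From matrices to isomorphisms of modules *)

Section Reindexing.
Variable F : fieldType.

Lemma mulmx_mxsub_bij (k l m n d e : nat) (f : 'I_k -> 'I_l) (g : 'I_m -> 'I_n)
    (h : 'I_e -> 'I_d) (A : 'M[F]_(l, d)) (B : 'M[F]_(d, n)) :
  bijective h -> mxsub f h A *m mxsub h g B = mxsub f g (A *m B).
Proof.
move=> bij_h; apply/matrixP => i j; rewrite !mxE [RHS](reindex h) /=.
  by apply: eq_bigr => t _; rewrite !mxE.
exact: onW_bij.
Qed.

End Reindexing.

Section ModulesOverGl1.
Variables (F : fieldType) (q : F).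

Lemma ractZ (A : algType F) (M : rep A) c a : M (c *: a) = c *: M a.
Proof.
have M0 : M 0 = 0 by have := ract_lin M (-1) 0 0; rewrite scaler0 addr0 scaleN1r addNr.
by rewrite -[c *: a]addr0 ract_lin M0 addr0.
Qed.

Lemma ractD (A : algType F) (M : rep A) a b : M (a + b) = M a + M b.
Proof. by have := ract_lin M 1 a b; rewrite !scale1r. Qed.

Lemma gl1_intertwine (M N : rep (gl1 q)) (P : 'M[F]_(rdim N, rdim M)) :
  P *m M (gB q) = N (gB q) *m P -> forall u, P *m M u = N u *m P.
Proof.
move=> PB.
(* Elements of [gl1] carry a membership proof; quantifying over it allows induction on
   [gen_subalg]. *)
suff PM u : gen_subalg (eq (uB q)) u -> forall Hu : u \in @gl1_pred F q,
    P *m M (Sub u Hu) = N (Sub u Hu) *m P.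
  by move=> [u Hu]; apply: PM; apply/asboolP.
have lift v : gen_subalg (eq (uB q)) v -> v \in @gl1_pred F q by move=> ?; apply/asboolP.
elim=> {u} [_ <-||c u Su IHu|u v Su IHu Sv IHv|u v Su IHu Sv IHv] Hu.
- by have -> : (Sub (uB q) Hu : gl1 q) = gB q by apply: val_inj.
- have -> : (Sub 1 Hu : gl1 q) = 1 :> gl1 q by apply: val_inj.
  by rewrite !ract1 mulmx1 mul1mx.
- have -> : (Sub (c *: u) Hu : gl1 q) = c *: (Sub u (lift _ Su) : gl1 q) by apply: val_inj.
  by rewrite !ractZ -scalemxAl -scalemxAr IHu.
- have -> : (Sub (u + v) Hu : gl1 q) = (Sub u (lift _ Su) : gl1 q) + (Sub v (lift _ Sv) : gl1 q).
    exact: val_inj.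
  by rewrite !ractD mulmxDl mulmxDr IHu IHv.
- have -> : (Sub (u * v) Hu : gl1 q) = (Sub u (lift _ Su) : gl1 q) * (Sub v (lift _ Sv) : gl1 q).
    exact: val_inj.
  by rewrite !ractM -mulmxA -IHv !mulmxA IHu.
Qed.

(** The dimensions of the two modules are different expressions, a product and a sum; both index
    sets are identified with ['I_d] by bijections. *)
Lemma rep_iso_reindex (M N : rep (gl1 q)) d (A B W : 'M[F]_d)
    (f : 'I_(rdim M) -> 'I_d) (g : 'I_(rdim N) -> 'I_d) :
  bijective f -> bijective g ->
  M (gB q) = mxsub f f A -> N (gB q) = mxsub g g B ->
  W \in unitmx -> W *m A = B *m W -> rep_iso M N.
Proof.
move=> bij_f bij_g MB NB W_unit WA.
have mxsub1 k (h : 'I_k -> 'I_d) : bijective h -> mxsub h h 1%:M = 1%:M :> 'M[F]_k.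
  by move=> /bij_inj inj_h; apply/matrixP => i j; rewrite !mxE (inj_eq inj_h).
exists (mxsub g f W), (mxsub f g (invmx W)); split.
- by rewrite mulmx_mxsub_bij // mulmxV // mxsub1.
- by rewrite mulmx_mxsub_bij // mulVmx // mxsub1.
- by apply: gl1_intertwine; rewrite MB NB !mulmx_mxsub_bij // WA.
Qed.

Hypotheses (q_neq0 : q != 0) (q_generic : forall i, q ^+ i.+1 != 1).

Lemma direct_sum_gl1_L_B n (lambda : 'I_n -> F) :
  direct_sum (fun j => gl1_L q_neq0 q_generic (lambda j)) (gB q)
  = mxsub tagnat.sig1 tagnat.sig1 (diag_mx (\row_j lambda j)).
Proof.
rewrite /= /dsum_act.
under eq_mxdiag => j do rewrite gl1_rep_B.
apply/matrixP => i j; rewrite !mxE.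
have [_|_] := eqVneq (tagnat.sig1 i) (tagnat.sig1 j); last by rewrite mxE.
by rewrite conform_mx_id mxE !(ord1 (tagnat.sig2 _)).
Qed.

Lemma gl1_tensor_L_B lambda (W : rep (Uq q)) :
  gl1_tensor q_neq0 q_generic (gl1_L q_neq0 q_generic lambda) W (gB q)
  = mxsub (fun i => (mxtens_unindex i).2) (fun i => (mxtens_unindex i).2)
      (lambda *: W (uKi q) + W (uB q)).
Proof.
rewrite gl1_rep_B [gl1_L _ _ _ _]gl1_rep_B; apply/matrixP => i j; rewrite !mxE.
by rewrite !(ord1 (mxtens_unindex _).1) eqxx mul1r.
Qed.

End ModulesOverGl1.

Lemma sig1_1_bij n : bijective (@tagnat.sig1 n (fun=> 1%N)).
Proof.
exists (fun j => tagnat.Rank (p_ := fun=> 1%N) j ord0) => j; last exact: tagnat.Rank1K.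
by rewrite -[RHS]tagnat.sig2K [tagnat.sig2 j]ord1.
Qed.

Lemma mxtens_unindex1_bij n : bijective (fun i : 'I_(1 * n) => (mxtens_unindex i).2).
Proof.
exists (fun j => mxtens_index (ord0, j)) => i; last by rewrite mxtens_indexK.
rewrite -[RHS]mxtens_unindexK; congr mxtens_index.
by rewrite [RHS]surjective_pairing [(_ i).1]ord1.
Qed.

Lemma gl1_L_tensor_V (F : fieldType) (q : F) (q_neq0 : q != 0)
    (q_generic : forall i, q ^+ i.+1 != 1) (n : int) (m : nat) (s : bool) :
  (2%:R : F) != 0 ->
  rep_iso
    (gl1_tensor q_neq0 q_generic (gl1_L q_neq0 q_generic (qint q n))
       (V_rep m s q_neq0 q_generic))
    (direct_sum (fun j : 'I_m.+1 => gl1_L q_neq0 q_generic (eig_val q n m s j))).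
Proof.
move=> two_neq0.
apply: (@rep_iso_reindex _ _ _ _ _ (twisted_B n m q_neq0 q_generic s) _ (eig_mx q n m)).
- exact: mxtens_unindex1_bij.
- exact: sig1_1_bij.
- rewrite gl1_tensor_L_B; congr (mxsub _ _ (_ *: _ + _)).
  exact: (Uq_act_class (V_relations m s q_neq0 q_generic)).
- exact: direct_sum_gl1_L_B.
- exact: eig_mx_unit.
- exact: eig_mx_twisted_B.
Qed.

Theorem corollary2p7 (R : realType) (n : int) (m : nat) (s : bool) :
  rep_iso
    (tensor (L (qn R[i] n)) (V R[i] m s))
    (direct_sum (fun j : 'I_m.+1 =>
       L ((-1) ^+ s * qn R[i] (n + m%:Z - 2 * j%:Z)))).
Proof.
apply: gl1_L_tensor_V.
(* What remains is that 2 is nonzero in C(q), which reduces to the constants. *)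
rewrite -tofrac1 -tofracMn tofrac_eq0.
by rewrite -polyC1 -polyCMn polyC_eq0 Num.Theory.pnatr_eq0.
Qed.
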